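(* Let $v(0)\in\mathcal N^*$ and $T>0$. Let $v^{crit}$ be the solution of the critical equations with initial condition $v(0)$, and $v^{sub}$ the solution of the subcritical equations with initial condition $v(0)$ and a continuous rate function $\lambda$ bounded below by a positive constant. Then $$\int_0^T\Phi^{sub}(t)dt-\int_0^T\lambda(t)dt\le\int_0^T\Phi^{crit}(t)dt.$$ If $v^{alt}$ is the solution of the alternating equations with initial condition $v(0)$ and an arbitrary sequence of burning times, then $$\int_0^T\Phi^{alt}(t)dt\le\int_0^T\Phi^{crit}(t)dt.$$
   Context: $\mathcal N$: sequences $v=(v_k)_{k\ge1}$ of nonnegative reals with $\sum_kv_k<\infty$; $\mathcal N^*$: those with finitely many nonzero terms; $m_0=\sum_kv_k$. Subcritical equations with rate $\lambda$: $v(t)\in\mathcal N$, $v_k(t)=v_k(0)+\int_0^t\big(\tfrac k2\sum_{l=1}^{k-1}v_lv_{k-l}-kv_km_0(s)-\lambda(s)kv_k\big)ds$ for all $k$, with $\Phi(t)=m_0(0)-m_0(t)$ nondecreasing in $[0,m_0(0))$. Critical equations: the same with $\lambda\equiv0$. For these, $\Phi^{sub}(t)=m_0(0)-m^{sub}_0(t)$, $\Phi^{crit}(t)=m_0(0)-m^{crit}_0(t)$. Alternating equations with burning times $0=\beta_0<\beta_1<\dots$ (no accumulation), $M(t)=\max\{i:\beta_i<t\}$: $\dot v_k=\tfrac k2\sum_{l=1}^{k-1}v_lv_{k-l}-kv_km_0(\beta_{M(t)})$, $v_k$ continuous; $\Phi^{alt}(t)=m_0(0)-m^{alt}_0(\beta_{M(t)})$.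 *)

(* Defs.v *)
From Stdlib Require Import Reals ClassicalEpsilon.
From Coquelicot Require Import Coquelicot.
Open Scope R_scope.

(* A sequence v = (v_k)_{k>=1} is represented by w : nat -> R, using indices k >= 1;
   the value w 0 is irrelevant and never used. *)

Definition m0 (w : nat -> R) : R := Series (fun n => w (S n)).

Definition in_N (w : nat -> R) : Prop :=
  (forall k : nat, (1 <= k)%nat -> 0 <= w k) /\ ex_series (fun n => w (S n)).

Definition in_Nstar (w : nat -> R) : Prop :=
  in_N w /\ exists K : nat, forall k : nat, (K < k)%nat -> w k = 0.

(* sum_{l=1}^{k-1} v_l v_{k-l}  (empty sum = 0 when k = 1) *)
Definition conv (w : nat -> R) (k : nat) : R :=
  sum_n_m (fun l => w l * w (k - l)%nat) 1 (k - 1).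

Definition coag_rhs (w : nat -> R) (k : nat) (m : R) : R :=
  INR k / 2 * conv w k - INR k * w k * m.

Definition Phi (v : R -> nat -> R) (t : R) : R := m0 (v 0) - m0 (v t).

Definition sub_sol (lam : R -> R) (v : R -> nat -> R) : Prop :=
  (forall t, 0 <= t -> in_N (v t)) /\
  (forall (k : nat) (t : R), (1 <= k)%nat -> 0 <= t ->
     is_RInt (fun s => coag_rhs (v s) k (m0 (v s)) - lam s * INR k * v s k)
             0 t (v t k - v 0 k)) /\
  (forall s t, 0 <= s -> s <= t -> Phi v s <= Phi v t) /\
  (forall t, 0 <= t -> 0 <= Phi v t < m0 (v 0)).

Definition crit_sol (v : R -> nat -> R) : Prop := sub_sol (fun _ => 0) v.

Definition burning (b : nat -> R) : Prop :=
  b 0%nat = 0 /\ (forall i, b i < b (S i)) /\ (forall x, exists i, x < b i).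

(* M(t) = max {i : b_i < t}, i.e. the i with b_i < t <= b_{i+1} (t > 0) *)
Definition Mtime (b : nat -> R) (t : R) : nat :=
  epsilon (inhabits 0%nat) (fun i => b i < t <= b (S i)).

Definition alt_sol (b : nat -> R) (v : R -> nat -> R) : Prop :=
  (forall t, 0 <= t -> in_N (v t)) /\
  (forall (k : nat) (t : R), (1 <= k)%nat -> 0 <= t ->
     filterlim (fun s => v s k) (within (fun s => 0 <= s) (locally t)) (locally (v t k))) /\
  (forall (k i : nat) (t : R), (1 <= k)%nat -> b i < t < b (S i) ->
     is_derive (fun s => v s k) t (coag_rhs (v t) k (m0 (v (b i))))).

Definition Phi_alt (v : R -> nat -> R) (b : nat -> R) (t : R) : R :=
  m0 (v 0) - m0 (v (b (Mtime b t))).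

(* Main.v *)
(** Let [theta] be the integral of [m0 (v 0) - mu], where [mu] is the total deletion rate:
    [m0 + lam] in the subcritical equations, [m0] in the critical ones, and the mass at the
    last burning time in the alternating ones. Changing [mu] while keeping the initial
    condition only multiplies [v_k] by [exp (k * (change of theta))]. Hence, at a time where
    [theta] exceeds the critical [theta_c], each [v_k], and so the mass, is at least the
    critical one; as [mu] is at least the mass, [theta - theta_c] does not increase there.
    Since it starts at [0], it never becomes positive, which is the claim in both cases.

    The mass is only known to be monotone and right continuous, so right derivatives are used. *)
Require Import Defs.
From Stdlib Require Import Reals Lra Lia ClassicalEpsilon.
From Coquelicot Require Import Coquelicot.
Open Scope R_scope.

(** * Right derivatives and continuity on [0, oo) *)

(* Right derivative. Asking for a differentiable [g] that agrees with [f] on [t, oo) transfers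
   the usual differentiation rules to one-sided derivatives. *)
Definition rderiv (f : R -> R) (t l : R) : Prop :=
  exists g : R -> R, is_derive g t l /\ forall s, t <= s -> f s = g s.

(** The limit is taken within [0, oo) because the equations constrain solutions at nonnegative times
    only. *)
Definition cont0 (f : R -> R) : Prop := forall t, 0 <= t ->
  filterlim f (within (fun s => 0 <= s) (locally t)) (locally (f t)).

Lemma within_eps (D : R -> Prop) (f : R -> R) (t y : R) :
  filterlim f (within D (locally t)) (locally y) <->
  forall eps, 0 < eps ->
    exists delta, 0 < delta /\
      forall s, D s -> Rabs (s - t) < delta -> Rabs (f s - y) < eps.
Proof.
  rewrite filterlim_locally; split.
  - intros H eps Heps.
    destruct (H (mkposreal eps Heps)) as [d Hd].
    exists d; split; [apply cond_pos|].
    intros s Ds Hs; exact (Hd s Hs Ds).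
  - intros H eps.
    destruct (H eps (cond_pos eps)) as [d [Hd H1]].
    exists (mkposreal d Hd); intros s Hs Ds; exact (H1 s Ds Hs).
Qed.

Lemma rderiv_intro (f : R -> R) (t l : R) :
  (forall eps, 0 < eps -> exists delta, 0 < delta /\
     forall s, t < s < t + delta -> Rabs (f s - f t - l * (s - t)) <= eps * (s - t)) ->
  rderiv f t l.
Proof.
  intros H.
  (* Left of [t] the witness follows the tangent line, so its left difference quotients equal [l]
     exactly. *)
  exists (fun s => if Rlt_dec s t then f t + l * (s - t) else f s); split.
  - apply is_derive_Reals; intros eps Heps.
    destruct (H (eps / 2)) as [d [Hd H1]]; [lra|].
    exists (mkposreal d Hd); simpl; intros h Hh Hhd.
    destruct (Rlt_dec t t) as [c|_]; [lra|].
    destruct (Rlt_dec (t + h) t) as [c|c].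
    + replace ((f t + l * (t + h - t) - f t) / h - l) with 0 by (field; lra).
      rewrite Rabs_R0; lra.
    + rewrite (Rabs_right h) in Hhd by lra.
      specialize (H1 (t + h)).
      replace ((f (t + h) - f t) / h - l)
        with ((f (t + h) - f t - l * (t + h - t)) / h) by (field; lra).
      unfold Rdiv; rewrite Rabs_mult, Rabs_inv, (Rabs_right h) by lra.
      apply Rle_lt_trans with (eps / 2); [|lra].
      apply Rmult_le_reg_r with h; [lra|].
      rewrite Rmult_assoc, Rinv_l, Rmult_1_r by lra.
      replace (eps / 2 * h) with (eps / 2 * (t + h - t)) by ring.
      apply H1; lra.
  - intros s Hs; destruct (Rlt_dec s t); lra.
Qed.

Lemma rderiv_elim (f : R -> R) (t l : R) : rderiv f t l ->
  forall eps, 0 < eps -> exists delta, 0 < delta /\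
    forall s, t < s < t + delta -> Rabs (f s - f t - l * (s - t)) <= eps * (s - t).
Proof.
  intros [g [Hg E]] eps Heps.
  apply is_derive_Reals in Hg.
  destruct (Hg eps Heps) as [d Hd].
  exists d; split; [apply cond_pos|]; intros s Hs.
  rewrite !E by lra.
  specialize (Hd (s - t)).
  replace (t + (s - t)) with s in Hd by ring.
  replace (g s - g t - l * (s - t)) with (((g s - g t) / (s - t) - l) * (s - t))
    by (field; lra).
  rewrite Rabs_mult, (Rabs_right (s - t)) by lra.
  apply Rmult_le_compat_r; [lra|]; left; apply Hd; [lra|].
  rewrite Rabs_right; lra.
Qed.

Lemma rderiv_const (c t : R) : rderiv (fun _ => c) t 0.
Proof. exists (fun _ => c); split; [apply @is_derive_const|reflexivity]. Qed.

Lemma rderiv_plus (f g : R -> R) (t l m : R) :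
  rderiv f t l -> rderiv g t m -> rderiv (fun s => f s + g s) t (l + m).
Proof.
  intros [f1 [Hf Ef]] [g1 [Hg Eg]]; exists (fun s => f1 s + g1 s); split.
  - now apply @is_derive_plus.
  - intros s Hs; now rewrite Ef, Eg.
Qed.

Lemma rderiv_minus (f g : R -> R) (t l m : R) :
  rderiv f t l -> rderiv g t m -> rderiv (fun s => f s - g s) t (l - m).
Proof.
  intros [f1 [Hf Ef]] [g1 [Hg Eg]]; exists (fun s => f1 s - g1 s); split.
  - now apply @is_derive_minus.
  - intros s Hs; now rewrite Ef, Eg.
Qed.

Lemma rderiv_mult (f g : R -> R) (t l m : R) :
  rderiv f t l -> rderiv g t m -> rderiv (fun s => f s * g s) t (l * g t + f t * m).
Proof.
  intros [f1 [Hf Ef]] [g1 [Hg Eg]]; exists (fun s => f1 s * g1 s); split.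
  - rewrite Ef, Eg by lra. apply (is_derive_mult f1 g1); auto. exact Rmult_comm.
  - intros s Hs; now rewrite Ef, Eg.
Qed.

Lemma rderiv_exp (f : R -> R) (t l : R) :
  rderiv f t l -> rderiv (fun s => exp (f s)) t (l * exp (f t)).
Proof.
  intros [f1 [Hf Ef]]; exists (fun s => exp (f1 s)); split.
  - rewrite Ef by lra. apply (is_derive_comp exp f1); [apply is_derive_exp|exact Hf].
  - intros s Hs; now rewrite Ef.
Qed.

(** * Comparison principles for right derivatives *)

(* A continuous induction on [a, b]: the set where [h <= 0] is closed by left continuity,
   and cannot stop because [h] has negative slope at each of its zeros. *)
Lemma rderiv_barrier (h l : R -> R) (a b : R) : 0 <= a -> cont0 h ->
  (forall t, a <= t < b -> rderiv h t (l t)) ->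
  (forall t, a <= t < b -> h t = 0 -> l t < 0) ->
  h a <= 0 -> a <= b -> h b <= 0.
Proof.
  intros Ha Hc Hd Hl Hha Hab.
  set (E := fun t => a <= t <= b /\ forall u, a <= u <= t -> h u <= 0).
  assert (Ea : E a).
  { split; [lra|]; intros u Hu; replace u with a by lra; exact Hha. }
  destruct (completeness E) as [s [Hub Hlub]].
  { exists b; intros t [Ht _]; lra. }
  { now exists a. }
  assert (Has : a <= s) by (now apply Hub).
  assert (Hsb : s <= b) by (apply Hlub; intros t [Ht _]; lra).
  assert (Hlt : forall u, a <= u < s -> h u <= 0).
  { intros u Hu; destruct (Rle_dec (h u) 0) as [c|c]; [exact c|exfalso].
    assert (s <= u); [|lra].
    apply Hlub; intros t [Ht Hu']. destruct (Rle_dec t u); [lra|].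
    destruct c; apply Hu'; lra. }
  assert (Hs : h s <= 0).
  { destruct (Req_dec s a) as [->|Hne]; [exact Hha|].
    destruct (Rle_dec (h s) 0) as [c|c]; [exact c|exfalso].
    destruct (proj1 (within_eps _ _ _ _) (Hc s ltac:(lra)) (h s) ltac:(lra)) as [d [Hd0 H]].
    set (u := Rmax a (s - d / 2)).
    assert (Hu : a <= u < s /\ s - d / 2 <= u).
    { unfold u; split; [split|]; [apply Rmax_l| |apply Rmax_r].
      apply Rmax_lub_lt; lra. }
    specialize (H u ltac:(lra)); specialize (Hlt u ltac:(lra)).
    rewrite (Rabs_left (u - s)) in H by lra.
    specialize (H ltac:(lra)); apply Rabs_def2 in H; lra. }
  destruct (Req_dec s b) as [->|Hne]; [exact Hs|exfalso].
  assert (Hd' := Hd s ltac:(lra)).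
  assert (K : exists d, 0 < d /\ forall u, s < u < s + d -> h u <= 0).
  { destruct (Req_dec (h s) 0) as [c|c].
    - specialize (Hl s ltac:(lra) c).
      (* With tolerance [- l s] the slope and the error cancel, leaving [h u <= 0] just after
         [s]. *)
      destruct (rderiv_elim _ _ _ Hd' (- l s) ltac:(lra)) as [d [Hd0 H]].
      exists d; split; [lra|]; intros u Hu; specialize (H u Hu).
      rewrite c in H; apply Rabs_le_between in H; lra.
    - destruct (proj1 (within_eps _ _ _ _) (Hc s ltac:(lra)) (- h s) ltac:(lra))
        as [d [Hd0 H]].
      exists d; split; [lra|]; intros u Hu; specialize (H u ltac:(lra)).
      rewrite Rabs_right in H by lra.
      specialize (H ltac:(lra)); apply Rabs_def2 in H; lra. }
  destruct K as [d [Hd0 K]].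
  set (u := Rmin b (s + d / 2)).
  assert (Hu : s < u <= b /\ u <= s + d / 2).
  { unfold u; split; [split|]; [|apply Rmin_l|apply Rmin_r].
    apply Rmin_glb_lt; lra. }
  assert (u <= s); [|lra].
  apply Hub; split; [lra|]; intros w Hw.
  destruct (Rle_dec w s).
  - destruct (Req_dec w s) as [->|]; [exact Hs|apply Hlt; lra].
  - apply K; lra.
Qed.

Lemma cont0_of_continuous (f : R -> R) : (forall t, 0 <= t -> continuous f t) -> cont0 f.
Proof.
  intros H t Ht; apply filterlim_filter_le_1 with (2 := H t Ht).
  intros P HP; unfold within; revert HP; apply filter_imp; auto.
Qed.

Lemma cont0_comp (f : R -> R) (g : R -> R) :
  cont0 f -> (forall x, continuous g x) -> cont0 (fun s => g (f s)).
Proof. intros Hf Hg t Ht; exact (filterlim_comp _ _ _ _ _ _ _ _ (Hf t Ht) (Hg (f t))). Qed.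

Lemma filterlim_Rplus (F : (R -> Prop) -> Prop) {FF : Filter F} (f g : R -> R) (l m : R) :
  filterlim f F (locally l) -> filterlim g F (locally m) ->
  filterlim (fun s => f s + g s) F (locally (l + m)).
Proof. intros Hf Hg; exact (filterlim_comp_2 f g Rplus Hf Hg (filterlim_plus l m)). Qed.

Lemma filterlim_Rmult (F : (R -> Prop) -> Prop) {FF : Filter F} (f g : R -> R) (l m : R) :
  filterlim f F (locally l) -> filterlim g F (locally m) ->
  filterlim (fun s => f s * g s) F (locally (l * m)).
Proof. intros Hf Hg; exact (filterlim_comp_2 f g Rmult Hf Hg (filterlim_mult l m)). Qed.

Lemma filterlim_Ropp (F : (R -> Prop) -> Prop) {FF : Filter F} (f : R -> R) (l : R) :
  filterlim f F (locally l) -> filterlim (fun s => - f s) F (locally (- l)).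
Proof. intros Hf; exact (filterlim_comp _ _ _ f Ropp _ _ _ Hf (filterlim_opp l)). Qed.

Lemma cont0_plus (f g : R -> R) : cont0 f -> cont0 g -> cont0 (fun s => f s + g s).
Proof.
  intros Hf Hg t Ht; exact (filterlim_Rplus _ f g (f t) (g t) (Hf t Ht) (Hg t Ht)).
Qed.

Lemma cont0_mult (f g : R -> R) : cont0 f -> cont0 g -> cont0 (fun s => f s * g s).
Proof.
  intros Hf Hg t Ht; exact (filterlim_Rmult _ f g (f t) (g t) (Hf t Ht) (Hg t Ht)).
Qed.

Lemma cont0_const (c : R) : cont0 (fun _ => c).
Proof. intros t Ht; apply filterlim_const. Qed.

Lemma cont0_minus (f g : R -> R) : cont0 f -> cont0 g -> cont0 (fun s => f s - g s).
Proof.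
  intros Hf Hg; apply cont0_plus; [exact Hf|].
  apply (cont0_comp g Ropp Hg); intros x.
  apply (ex_derive_continuous Ropp); auto_derive; trivial.
Qed.

(* Comparison with the barrier [eps * exp ((C + 1) * (t - a))], which stays below 1 for
   small [eps]: the differential inequality is needed only where [0 < f <= 1]. *)
Lemma rderiv_gronwall (f l : R -> R) (C a b : R) : 0 <= a -> cont0 f ->
  (forall t, a <= t < b -> rderiv f t (l t)) ->
  (forall t, a <= t < b -> 0 < f t <= 1 -> l t <= C * f t) ->
  f a <= 0 -> a <= b -> f b <= 0.
Proof.
  intros Ha Hc Hd Hl Hfa Hab.
  (* The absolute value keeps the rate positive even for negative [C]: the barrier is then
     increasing, and [B] bounds its factor on the whole interval. *)
  set (C1 := Rabs C + 1).
  assert (HC : C < C1 /\ 0 < C1).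
  { unfold C1; pose proof (Rabs_pos C); pose proof (Rle_abs C); lra. }
  set (B := exp (C1 * (b - a))).
  assert (HB : 0 < B) by apply exp_pos.
  assert (Hexp : forall t, t <= b -> exp (C1 * (t - a)) <= B).
  { intros t Ht; unfold B; destruct (Rle_lt_or_eq_dec t b Ht) as [c| ->]; [|lra].
    left; apply exp_increasing, Rmult_lt_compat_l; lra. }
  assert (Hder : forall t, is_derive (fun s => exp (C1 * (s - a))) t (C1 * exp (C1 * (t - a)))).
  { intros t; auto_derive; [trivial|unfold Rminus; ring]. }
  assert (Hmain : forall eps, 0 < eps -> eps * B <= 1 -> f b <= eps * B).
  { intros eps Heps HeB.
    cut (f b - eps * exp (C1 * (b - a)) <= 0); [unfold B; lra|].
    apply (rderiv_barrier (fun s => f s - eps * exp (C1 * (s - a)))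
             (fun t => l t - (0 * exp (C1 * (t - a)) + eps * (C1 * exp (C1 * (t - a))))) a b Ha).
    - apply cont0_minus; [exact Hc|].
      apply cont0_mult; [apply cont0_const|].
      apply cont0_of_continuous; intros t _.
      apply (ex_derive_continuous (fun s => exp (C1 * (s - a)))); eexists; apply Hder.
    - intros t Ht; apply rderiv_minus; [now apply Hd|].
      apply (rderiv_mult (fun _ => eps) (fun s => exp (C1 * (s - a)))); [apply rderiv_const|].
      exists (fun s => exp (C1 * (s - a))); split; [apply Hder|reflexivity].
    - intros t Ht E0.
      pose proof (exp_pos (C1 * (t - a))) as He.
      assert (Hf : f t = eps * exp (C1 * (t - a))) by lra.
      assert (0 < f t) by (rewrite Hf; now apply Rmult_lt_0_compat).
      assert (eps * exp (C1 * (t - a)) <= eps * B)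
        by (apply Rmult_le_compat_l; [lra|apply Hexp; lra]).
      specialize (Hl t Ht ltac:(lra)).
      assert (C * f t < C1 * f t) by (apply Rmult_lt_compat_r; lra).
      rewrite Hf in H1 at 2. lra.
    - pose proof (exp_pos (C1 * (a - a))).
      assert (0 < eps * exp (C1 * (a - a))) by (now apply Rmult_lt_0_compat). lra.
    - exact Hab. }
  destruct (Rle_dec (f b) 0) as [c|c]; [exact c|exfalso].
  (* The choice [eps = y / B] respects the bound 1 and would give [f b <= f b / 2], which is absurd
     for positive [f b]. *)
  set (y := Rmin 1 (f b / 2)).
  assert (Hy : 0 < y /\ y <= 1 /\ y <= f b / 2).
  { unfold y; split; [apply Rmin_glb_lt; lra|]; split; [apply Rmin_l|apply Rmin_r]. }
  specialize (Hmain (y / B)).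
  replace (y / B * B) with y in Hmain by (field; lra).
  specialize (Hmain ltac:(apply Rdiv_lt_0_compat; lra) ltac:(lra)). lra.
Qed.

Lemma rderiv_ext (f g : R -> R) (t l : R) :
  (forall s, t <= s -> f s = g s) -> rderiv f t l -> rderiv g t l.
Proof.
  intros E [h [Hh Eh]]; exists h; split; [exact Hh|].
  intros s Hs; rewrite <- E; auto.
Qed.

Lemma cont0_ext (f g : R -> R) : (forall s, 0 <= s -> f s = g s) -> cont0 f -> cont0 g.
Proof.
  intros E Hf t Ht; rewrite <- (E t Ht); apply within_eps; intros eps Heps.
  destruct (proj1 (within_eps _ _ _ _) (Hf t Ht) eps Heps) as [d [Hd H]].
  exists d; split; [exact Hd|]; intros s Ds Hs; rewrite <- E by exact Ds; auto.
Qed.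

Lemma cont0_at_right (f : R -> R) (t : R) :
  0 <= t -> cont0 f -> filterlim f (at_right t) (locally (f t)).
Proof.
  intros Ht Hf; apply within_eps; intros eps Heps.
  destruct (proj1 (within_eps _ _ _ _) (Hf t Ht) eps Heps) as [d [Hd H]].
  exists d; split; [exact Hd|]; intros s Ds Hs; apply H; lra.
Qed.

(** * Riemann integrability of monotone functions *)

Definition threshold (y x : R) : R := if Rle_dec y x then 1 else 0.

Lemma ex_RInt_threshold (f : R -> R) (y a b : R) : a <= b ->
  (forall s t, s <= t -> f s <= f t) -> ex_RInt (fun s => threshold y (f s)) a b.
Proof.
  intros Hab Hf.
  (* By monotonicity the integrand jumps at most once, at this supremum. The alternative [s = a]
     keeps the set nonempty when [f] never lies below [y]. *)
  destruct (completeness (fun s => a <= s <= b /\ (s = a \/ f s < y))) as [c [Hub Hlub]].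
  { exists b; intros t [Ht _]; lra. }
  { exists a; split; [lra|now left]. }
  assert (Hac : a <= c) by (apply Hub; split; [lra|now left]).
  assert (Hcb : c <= b) by (apply Hlub; intros t [Ht _]; lra).
  apply ex_RInt_Chasles with c.
  - apply ex_RInt_ext with (fun _ => 0); [|apply ex_RInt_const].
    rewrite Rmin_left, Rmax_right by lra; intros x Hx.
    unfold threshold; destruct (Rle_dec y (f x)) as [h|h]; [exfalso|reflexivity].
    assert (c <= x); [|lra].
    apply Hlub; intros t [Ht [->|Ht']]; [lra|].
    destruct (Rle_dec t x) as [k|k]; [exact k|].
    specialize (Hf x t); lra.
  - apply ex_RInt_ext with (fun _ => 1); [|apply ex_RInt_const].
    rewrite Rmin_left, Rmax_right by lra; intros x Hx.
    unfold threshold; destruct (Rle_dec y (f x)) as [h|h]; [reflexivity|exfalso].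
    assert (x <= c); [|lra].
    apply Hub; split; [lra|right; lra].
Qed.

(* [h] times the number of [j] in [1 .. N] with [j * h <= x]: rounds [x] down to a multiple
   of [h], as long as [x < N * h]. *)
Fixpoint stair (h : R) (N : nat) (x : R) : R :=
  match N with
  | O => 0
  | S n => stair h n x + h * threshold (INR (S n) * h) x
  end.

Lemma stair_approx (h x : R) (N : nat) : 0 < h -> 0 <= x ->
  (INR N * h <= x /\ stair h N x = INR N * h) \/
  (x < INR N * h /\ x - h <= stair h N x <= x).
Proof.
  intros Hh Hx; induction N as [|n IH].
  - left; simpl; lra.
  - cbn [stair]; unfold threshold; rewrite S_INR.
    destruct (Rle_dec ((INR n + 1) * h) x); lra.
Qed.

Lemma ex_RInt_stair (f : R -> R) (h : R) (N : nat) (a b : R) : a <= b ->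
  (forall s t, s <= t -> f s <= f t) -> ex_RInt (fun s => stair h N (f s)) a b.
Proof.
  intros Hab Hf; induction N as [|n IH]; [exact (ex_RInt_const a b 0)|].
  apply (ex_RInt_plus (fun s => stair h n (f s))); [exact IH|].
  apply (ex_RInt_scal (fun s => threshold (INR (S n) * h) (f s))).
  now apply ex_RInt_threshold.
Qed.

(** A bounded monotone function is a uniform limit of staircases of itself, each a finite sum of
    single-jump functions, and integrability passes to uniform limits. *)
Lemma ex_RInt_nondecreasing (f : R -> R) (a b : R) : a <= b ->
  (forall s t, a <= s -> s <= t -> t <= b -> f s <= f t) -> ex_RInt f a b.
Proof.
  intros Hab Hf.
  (* Clamping the argument to [a, b] gives monotonicity and boundedness on the whole line, where
     uniform convergence is required; subtracting [f a] makes the values nonnegative, as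
     [stair_approx] asks. *)
  set (c := fun s => Rmax a (Rmin b s)).
  assert (Hc : forall s, a <= c s <= b).
  { intros s; unfold c; split; [apply Rmax_l|apply Rmax_lub; [lra|apply Rmin_l]]. }
  set (g := fun s => f (c s) - f a).
  assert (Hg : forall s t, s <= t -> g s <= g t).
  { intros s t Hst; unfold g; apply Rplus_le_compat_r, Hf; [apply Hc| |apply Hc].
    unfold c; apply Rle_max_compat_l, Rle_min_compat_l, Hst. }
  assert (Hg0 : forall s, 0 <= g s <= f b - f a).
  { intros s; specialize (Hc s); unfold g.
    pose proof (Hf a (c s)); pose proof (Hf (c s) b); lra. }
  (* The added 1 makes [M] positive and strictly larger than [g], so the staircase of [S n] steps of
     height [M / INR (S n)] never saturates and errs by at most one step. *)
  set (M := f b - f a + 1).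
  assert (HM : 0 < M) by (specialize (Hg0 a); unfold M; lra).
  set (u := fun n s => stair (M / INR (S n)) (S n) (g s)).
  assert (HS : forall n, 0 < INR (S n)) by (intros; apply lt_0_INR; lia).
  assert (Eg : ex_RInt g a b).
  { destruct (filterlim_RInt u a b eventually _ g (fun n => RInt (u n) a b))
      as [If [_ HIf]].
    - intros n; apply (RInt_correct (u n)), ex_RInt_stair; auto.
    - apply filterlim_locally; intros eps.
      destruct (archimed_cor1 (eps / M)) as [N [HN HN0]].
      { apply Rdiv_lt_0_compat; [apply cond_pos|exact HM]. }
      exists N; intros n Hn s.
      assert (Hh : 0 < M / INR (S n)) by (now apply Rdiv_lt_0_compat).
      assert (HNh : INR (S n) * (M / INR (S n)) = M) by (field; specialize (HS n); lra).
      assert (M / INR (S n) < eps).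
      { apply Rle_lt_trans with (M * / INR N).
        - apply Rmult_le_compat_l; [lra|]; apply Rinv_le_contravar.
          + now apply lt_0_INR.
          + apply le_INR; lia.
        - replace (pos eps) with (M * (eps / M)) by (field; lra).
          now apply Rmult_lt_compat_l. }
      change (Rabs (u n s - g s) < eps).
      destruct (Hg0 s) as [H0 H1].
      destruct (stair_approx (M / INR (S n)) (g s) (S n) Hh H0) as [[h _]|[_ h]].
      + exfalso; rewrite HNh in h; unfold M in h; lra.
      + unfold u; apply Rabs_def1; lra.
    - now exists If. }
  apply ex_RInt_ext with (fun s => plus (g s) (f a)).
  - rewrite Rmin_left, Rmax_right by lra; intros x Hx.
    unfold g, c; rewrite Rmin_right, Rmax_right by lra; unfold plus; simpl; ring.
  - apply (ex_RInt_plus g (fun _ => f a)); [exact Eg|apply ex_RInt_const].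
Qed.

(** * The integral as a function of its upper limit *)

Lemma ex_RInt_from (g : R -> R) (s t : R) : (forall t, 0 <= t -> ex_RInt g 0 t) ->
  0 <= s -> 0 <= t -> ex_RInt g s t.
Proof.
  intros Hg Hs Ht; apply ex_RInt_Chasles with 0; [apply ex_RInt_swap|]; auto.
Qed.

Lemma RInt_diff (g : R -> R) (s t : R) : (forall t, 0 <= t -> ex_RInt g 0 t) ->
  0 <= s -> 0 <= t -> RInt g 0 t - RInt g 0 s = RInt g s t.
Proof.
  intros Hg Hs Ht.
  pose proof (RInt_Chasles g 0 s t (Hg s Hs) (ex_RInt_from g s t Hg Hs Ht)) as E.
  unfold plus in E; simpl in E; lra.
Qed.

Lemma RInt_Rconst (c a b : R) : RInt (fun _ => c) a b = (b - a) * c.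
Proof. exact (RInt_const a b c). Qed.

Lemma rderiv_RInt (g : R -> R) (t l : R) : 0 <= t -> (forall t, 0 <= t -> ex_RInt g 0 t) ->
  filterlim g (at_right t) (locally l) -> rderiv (RInt g 0) t l.
Proof.
  intros Ht Hg Hl; apply rderiv_intro; intros eps Heps.
  destruct (proj1 (within_eps _ _ _ _) Hl eps Heps) as [d [Hd H]].
  exists d; split; [exact Hd|]; intros s Hs.
  rewrite (RInt_diff g t s Hg Ht ltac:(lra)).
  assert (E := ex_RInt_from g t s Hg Ht ltac:(lra)).
  assert (Hb : forall x, t < x < s -> l - eps <= g x <= l + eps).
  { intros x Hx; specialize (H x ltac:(lra)).
    rewrite Rabs_right in H by lra; specialize (H ltac:(lra)).
    apply Rabs_def2 in H; lra. }
  assert (RInt g t s <= RInt (fun _ => l + eps) t s).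
  { apply RInt_le; [lra|exact E|apply ex_RInt_const|]; intros x Hx; apply Hb, Hx. }
  assert (RInt (fun _ => l - eps) t s <= RInt g t s).
  { apply RInt_le; [lra|apply ex_RInt_const|exact E|]; intros x Hx; apply Hb, Hx. }
  rewrite RInt_Rconst in H0, H1; apply Rabs_le; lra.
Qed.

Lemma cont0_RInt (g : R -> R) : (forall t, 0 <= t -> ex_RInt g 0 t) -> cont0 (RInt g 0).
Proof.
  intros Hg t Ht; apply within_eps; intros eps Heps.
  (* An integrable function is bounded, so its integral is Lipschitz; the endpoint [t + 1] leaves
     room for [s] on both sides of [t]. *)
  destruct (ex_RInt_ub g 0 (t + 1) (Hg (t + 1) ltac:(lra))) as [M HM].
  rewrite Rmin_left, Rmax_right in HM by lra.
  change (forall x, 0 <= x <= t + 1 -> Rabs (g x) <= M) in HM.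
  assert (HM0 : 0 <= M) by (eapply Rle_trans; [apply Rabs_pos|apply (HM 0); lra]).
  assert (Hle : forall x y, 0 <= x <= y -> y <= t + 1 -> Rabs (RInt g x y) <= (y - x) * M).
  { intros x y Hx Hy; apply abs_RInt_le_const; [lra|apply ex_RInt_from; auto; lra|].
    intros z Hz; apply HM; lra. }
  exists (Rmin 1 (eps / (M + 1))); split.
  { apply Rmin_glb_lt; [lra|apply Rdiv_lt_0_compat; lra]. }
  intros s Ds Hs.
  assert (H1 := Rlt_le_trans _ _ _ Hs (Rmin_l _ _)).
  assert (H2 := Rlt_le_trans _ _ _ Hs (Rmin_r _ _)); clear Hs.
  assert (H3 : Rabs (RInt g 0 s - RInt g 0 t) <= Rabs (s - t) * M).
  { apply Rabs_def2 in H1; destruct (Rle_dec t s).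
    - rewrite RInt_diff, (Rabs_right (s - t)) by (auto; lra); apply Hle; lra.
    - rewrite Rabs_minus_sym, RInt_diff, (Rabs_left (s - t)) by (auto; lra).
      replace (- (s - t)) with (t - s) by ring; apply Hle; lra. }
  apply Rle_lt_trans with (1 := H3).
  apply Rle_lt_trans with (Rabs (s - t) * (M + 1)).
  - apply Rmult_le_compat_l; [apply Rabs_pos|lra].
  - apply Rmult_lt_reg_r with (/ (M + 1)); [apply Rinv_0_lt_compat; lra|].
    rewrite Rmult_assoc, Rinv_r, Rmult_1_r by lra; exact H2.
Qed.

(** * Finite sums and right limits of the coagulation terms *)

Lemma cont0_sum (F : R -> nat -> R) (n m : nat) :
  (forall k, (n <= k <= m)%nat -> cont0 (fun s => F s k)) ->
  cont0 (fun s => sum_n_m (F s) n m).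
Proof.
  induction m as [|m IH]; intros H.
  - destruct n as [|n].
    + apply cont0_ext with (fun s => F s 0%nat); [|apply H; lia].
      intros s _; now rewrite sum_n_n.
    + apply cont0_ext with (fun _ => 0); [|apply cont0_const].
      intros s _; now rewrite sum_n_m_zero by lia.
  - destruct (Compare_dec.le_lt_dec n (S m)) as [c|c].
    + apply cont0_ext with (fun s => sum_n_m (F s) n m + F s (S m)).
      * intros s _; now rewrite sum_n_Sm by lia.
      * apply cont0_plus; [apply IH; intros; apply H|apply H]; lia.
    + apply cont0_ext with (fun _ => 0); [|apply cont0_const].
      intros s _; now rewrite sum_n_m_zero by lia.
Qed.

Lemma rderiv_sum (F : R -> nat -> R) (l : nat -> R) (t : R) (n m : nat) :
  (forall k, (n <= k <= m)%nat -> rderiv (fun s => F s k) t (l k)) ->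
  rderiv (fun s => sum_n_m (F s) n m) t (sum_n_m l n m).
Proof.
  induction m as [|m IH]; intros H.
  - destruct n as [|n].
    + rewrite sum_n_n; apply rderiv_ext with (fun s => F s 0%nat); [|apply H; lia].
      intros s _; now rewrite sum_n_n.
    + rewrite sum_n_m_zero by lia; apply rderiv_ext with (fun _ => 0); [|apply rderiv_const].
      intros s _; now rewrite sum_n_m_zero by lia.
  - destruct (Compare_dec.le_lt_dec n (S m)) as [c|c].
    + rewrite sum_n_Sm by lia; apply rderiv_ext with (fun s => sum_n_m (F s) n m + F s (S m)).
      * intros s _; now rewrite sum_n_Sm by lia.
      * apply rderiv_plus; [apply IH; intros; apply H|apply H]; lia.
    + rewrite sum_n_m_zero by lia; apply rderiv_ext with (fun _ => 0); [|apply rderiv_const].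
      intros s _; now rewrite sum_n_m_zero by lia.
Qed.

Lemma coag_rhs_at_right (v : R -> nat -> R) (mu : R -> R) (k : nat) (t m : R) :
  0 <= t -> (1 <= k)%nat -> (forall j, (1 <= j)%nat -> cont0 (fun s => v s j)) ->
  filterlim mu (at_right t) (locally m) ->
  filterlim (fun s => coag_rhs (v s) k (mu s)) (at_right t) (locally (coag_rhs (v t) k m)).
Proof.
  intros Ht Hk Hv Hmu; unfold coag_rhs, Rminus.
  assert (Hc : cont0 (fun s => conv (v s) k)).
  { apply (cont0_sum (fun s l => v s l * v s (k - l)%nat)); intros j Hj.
    apply cont0_mult; apply Hv; lia. }
  apply (filterlim_Rplus (at_right t)).
  - apply (filterlim_Rmult (at_right t)); [apply filterlim_const|].
    now apply (cont0_at_right (fun s => conv (v s) k)).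
  - apply (filterlim_Ropp (at_right t)), (filterlim_Rmult (at_right t)); [|exact Hmu].
    apply (filterlim_Rmult (at_right t)); [apply filterlim_const|].
    now apply (cont0_at_right (fun s => v s k)), Hv.
Qed.

Lemma sum_n_m_Rext (a c : nat -> R) (n m : nat) :
  (forall k, (n <= k <= m)%nat -> a k = c k) -> sum_n_m a n m = sum_n_m c n m.
Proof. exact (sum_n_m_ext_loc a c n m). Qed.

Lemma sum_n_m_le_loc (a c : nat -> R) (n m : nat) :
  (forall k, (n <= k <= m)%nat -> a k <= c k) -> sum_n_m a n m <= sum_n_m c n m.
Proof.
  intros H.
  (* The maximum agrees with [c] on the range of summation and dominates [a] at every index, as
     [sum_n_m_le] demands. *)
  rewrite (sum_n_m_Rext c (fun k => Rmax (a k) (c k))).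
  - apply sum_n_m_le; intros k; apply Rmax_l.
  - intros k Hk; rewrite Rmax_right; auto.
Qed.

Lemma sum_n_m_1_S (a : nat -> R) (n : nat) :
  sum_n_m a 1 (S n) = sum_n_m a 1 n + a (S n).
Proof. rewrite sum_n_Sm by lia; reflexivity. Qed.

Lemma sum_n_m_Rscal (c : R) (a : nat -> R) (n m : nat) :
  sum_n_m (fun k => c * a k) n m = c * sum_n_m a n m.
Proof. exact (sum_n_m_mult_l c a n m). Qed.

Lemma sum_n_m_Rplus (a c : nat -> R) (n m : nat) :
  sum_n_m (fun k => a k + c k) n m = sum_n_m a n m + sum_n_m c n m.
Proof. exact (sum_n_m_plus a c n m). Qed.

(** * Total mass as a supremum of partial sums *)

Lemma partial_sums_cv (w : nat -> R) : in_N w -> is_lim_seq (fun n => sum_n_m w 1 (S n)) (m0 w).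
Proof.
  intros [_ Hs].
  apply is_lim_seq_ext with (sum_n (fun n => w (S n))).
  - intros n; unfold sum_n; apply sum_n_m_S.
  - exact (Series_correct _ Hs).
Qed.

Lemma partial_sum_le_m0 (w : nat -> R) (K : nat) : in_N w -> sum_n_m w 1 K <= m0 w.
Proof.
  intros Hw; apply Rle_trans with (sum_n_m w 1 (S K)).
  - rewrite sum_n_m_1_S; pose proof (proj1 Hw (S K) ltac:(lia)); lra.
  - apply (is_lim_seq_incr_compare (fun n => sum_n_m w 1 (S n))).
    + now apply partial_sums_cv.
    + intros n; rewrite (sum_n_m_1_S w (S n)).
      pose proof (proj1 Hw (S (S n)) ltac:(lia)); lra.
Qed.

Lemma m0_approx (w : nat -> R) (eps : R) : in_N w -> 0 < eps ->
  exists K, m0 w - eps < sum_n_m w 1 K.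
Proof.
  intros Hw Heps.
  destruct (proj2 (is_lim_seq_spec _ _) (partial_sums_cv w Hw) (mkposreal eps Heps)) as [N HN].
  exists (S N); specialize (HN N (le_n N)); simpl in HN.
  apply Rabs_def2 in HN; lra.
Qed.

Lemma m0_nonneg (w : nat -> R) : in_N w -> 0 <= m0 w.
Proof.
  intros Hw; pose proof (partial_sum_le_m0 w 0 Hw) as H.
  rewrite sum_n_m_zero in H by lia; exact H.
Qed.

Lemma m0_le_of_partial_sums (w : nat -> R) (c : R) : in_N w ->
  (forall K, sum_n_m w 1 K <= c) -> m0 w <= c.
Proof.
  intros Hw H; destruct (Rle_dec (m0 w) c) as [h|h]; [exact h|exfalso].
  destruct (m0_approx w (m0 w - c) Hw ltac:(lra)) as [K HK].
  specialize (H K); lra.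
Qed.

(* [m0 (v s)] is lower semicontinuous, as a supremum of continuous partial sums;
   together with monotonicity this yields right continuity. *)
Lemma m0_at_right (v : R -> nat -> R) (t : R) : 0 <= t ->
  (forall s, 0 <= s -> in_N (v s)) ->
  (forall k, (1 <= k)%nat -> cont0 (fun s => v s k)) ->
  (forall s, t <= s -> m0 (v s) <= m0 (v t)) ->
  filterlim (fun s => m0 (v s)) (at_right t) (locally (m0 (v t))).
Proof.
  intros Ht HN Hc Hm; apply within_eps; intros eps Heps.
  destruct (m0_approx (v t) (eps / 2) (HN t Ht) ltac:(lra)) as [K HK].
  assert (HS : cont0 (fun s => sum_n_m (v s) 1 K))
    by (apply (cont0_sum v); intros; apply Hc; lia).
  destruct (proj1 (within_eps _ _ _ _) (HS t Ht) (eps / 2) ltac:(lra)) as [d [Hd H]].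
  exists d; split; [exact Hd|]; intros s Ds Hs.
  specialize (H s ltac:(lra) Hs); apply Rabs_def2 in H.
  pose proof (partial_sum_le_m0 (v s) K (HN s ltac:(lra))).
  specialize (Hm s ltac:(lra)); apply Rabs_def1; lra.
Qed.

(** * Comparison of two coagulation flows *)

(* [v] solves the coagulation equations with total deletion rate [mu];
   [theta] is the integral of [M - mu], where [M] stands for the initial mass. *)
Record coag_flow (M : R) (v : R -> nat -> R) (mu theta : R -> R) : Prop := {
  flow_cont : forall k, (1 <= k)%nat -> cont0 (fun s => v s k);
  flow_rderiv : forall k t, (1 <= k)%nat -> 0 <= t ->
    rderiv (fun s => v s k) t (coag_rhs (v t) k (mu t));
  flow_theta_cont : cont0 theta;
  flow_theta_0 : theta 0 = 0;
  flow_theta_rderiv : forall t, 0 <= t -> rderiv theta t (M - mu t) }.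

(** The factors for [l] and [k - l] multiply to the factor for [k]. Only indices below [k] are
    involved, which permits strong induction on [k]. *)
Lemma conv_scal (w u : nat -> R) (d : R) (k : nat) :
  (forall j, (1 <= j < k)%nat -> w j = exp (INR j * d) * u j) ->
  conv w k = exp (INR k * d) * conv u k.
Proof.
  intros H; unfold conv; rewrite <- sum_n_m_Rscal.
  apply sum_n_m_Rext; intros l Hl; rewrite !H by lia.
  replace (INR k * d) with (INR l * d + INR (k - l) * d)
    by (rewrite minus_INR by lia; ring).
  rewrite exp_plus; ring.
Qed.

(** By strong induction on [k]: once the exponential is moved to the other side, the gain terms of
    the two flows coincide, and the difference [w] solves the linear equation w' = - k mu2 w with
    w(0) = 0, hence vanishes. *)
Lemma coag_flow_gauge (M : R) (v1 v2 : R -> nat -> R) (mu1 mu2 th1 th2 : R -> R) :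
  coag_flow M v1 mu1 th1 -> coag_flow M v2 mu2 th2 ->
  (forall t, 0 <= t -> 0 <= mu2 t) ->
  (forall k, (1 <= k)%nat -> v1 0 k = v2 0 k) ->
  forall k t, (1 <= k)%nat -> 0 <= t ->
    v1 t k = exp (INR k * (th1 t - th2 t)) * v2 t k.
Proof.
  intros F1 F2 Hmu H0 k.
  induction k as [k IH] using (well_founded_induction Wf_nat.lt_wf); intros t Hk Ht.
  set (w := fun s => v1 s k * exp (- INR k * (th1 s - th2 s)) - v2 s k).
  set (l := fun s => - INR k * mu2 s * w s).
  assert (Hw0 : w 0 = 0).
  { unfold w; rewrite (flow_theta_0 _ _ _ _ F1), (flow_theta_0 _ _ _ _ F2), H0 by exact Hk.
    rewrite Rminus_diag, Rmult_0_r, exp_0; ring. }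
  assert (Hwc : cont0 w).
  { apply cont0_minus; [|now apply (flow_cont _ _ _ _ F2)].
    apply cont0_mult; [now apply (flow_cont _ _ _ _ F1)|].
    apply (cont0_comp (fun s => - INR k * (th1 s - th2 s)) exp).
    - apply cont0_mult; [apply cont0_const|apply cont0_minus].
      + apply (flow_theta_cont _ _ _ _ F1).
      + apply (flow_theta_cont _ _ _ _ F2).
    - intros x; apply (ex_derive_continuous exp); auto_derive; trivial. }
  assert (Hwd : forall s, 0 <= s -> rderiv w s (l s)).
  { intros s Hs.
    set (E := exp (- INR k * (th1 s - th2 s))).
    (* The expression substituted is what the product and chain rules produce; [M] and [mu1] cancel
       in it. *)
    replace (l s) with
      (coag_rhs (v1 s) k (mu1 s) * E
       + v1 s k * ((0 * (th1 s - th2 s) + - INR k * ((M - mu1 s) - (M - mu2 s))) * E)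
       - coag_rhs (v2 s) k (mu2 s)).
    - apply rderiv_minus; [|now apply (flow_rderiv _ _ _ _ F2)].
      apply rderiv_mult; [now apply (flow_rderiv _ _ _ _ F1)|].
      apply (rderiv_exp (fun s => - INR k * (th1 s - th2 s))).
      apply (rderiv_mult (fun _ => - INR k) (fun s => th1 s - th2 s)); [apply rderiv_const|].
      apply rderiv_minus; [now apply (flow_theta_rderiv _ _ _ _ F1)|
                           now apply (flow_theta_rderiv _ _ _ _ F2)].
    - assert (HC : conv (v1 s) k * E = conv (v2 s) k).
      { rewrite (conv_scal (v1 s) (v2 s) (th1 s - th2 s)) by (intros; apply IH; lia || lra).
        unfold E; rewrite Rmult_comm, <- Rmult_assoc, <- exp_plus.
        replace (_ + _) with 0 by ring; rewrite exp_0; ring. }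
      unfold l, w; fold E; unfold coag_rhs; rewrite <- HC; ring. }
  (* As [mu2] is nonnegative, [w] does not increase where it is positive, and neither does [- w];
     the comparison with constant 0 serves both signs. *)
  assert (Hle : w t <= 0).
  { apply (rderiv_gronwall w l 0 0 t); auto; try lra.
    - intros s Hs; apply Hwd; lra.
    - intros s Hs Hws; unfold l; pose proof (pos_INR k); specialize (Hmu s ltac:(lra)).
      assert (0 <= INR k * mu2 s * w s) by (repeat apply Rmult_le_pos; lra). lra. }
  assert (Hge : 0 - w t <= 0).
  { apply (rderiv_gronwall (fun s => 0 - w s) (fun s => 0 - l s) 0 0 t); auto; try lra.
    - apply cont0_minus; [apply cont0_const|exact Hwc].
    - intros s Hs; apply rderiv_minus; [apply rderiv_const|apply Hwd; lra].
    - intros s Hs Hws; unfold l; pose proof (pos_INR k); specialize (Hmu s ltac:(lra)).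
      assert (0 <= INR k * mu2 s * (0 - w s)) by (repeat apply Rmult_le_pos; lra). lra. }
  assert (Ew : v1 t k * exp (- INR k * (th1 t - th2 t)) = v2 t k) by (unfold w in *; lra).
  rewrite <- Ew, (Rmult_comm (v1 t k)), <- Rmult_assoc, <- exp_plus.
  replace (_ + _) with 0 by ring; rewrite exp_0; ring.
Qed.

Lemma coag_flow_theta_le (M : R) (v1 v2 : R -> nat -> R) (mu1 th1 th2 : R -> R) :
  coag_flow M v1 mu1 th1 -> coag_flow M v2 (fun t => m0 (v2 t)) th2 ->
  (forall t, 0 <= t -> in_N (v1 t)) -> (forall t, 0 <= t -> in_N (v2 t)) ->
  (forall t, 0 <= t -> m0 (v1 t) <= mu1 t) ->
  (forall k, (1 <= k)%nat -> v1 0 k = v2 0 k) ->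
  forall t, 0 <= t -> th1 t <= th2 t.
Proof.
  intros F1 F2 N1 N2 Hmu H0 t Ht.
  cut (th1 t - th2 t <= 0); [lra|].
  apply (rderiv_gronwall (fun s => th1 s - th2 s)
           (fun s => (M - mu1 s) - (M - m0 (v2 s))) 0 0 t); try lra.
  - apply cont0_minus; [apply (flow_theta_cont _ _ _ _ F1)|apply (flow_theta_cont _ _ _ _ F2)].
  - intros s Hs; apply rderiv_minus;
      [apply (flow_theta_rderiv _ _ _ _ F1)|apply (flow_theta_rderiv _ _ _ _ F2)]; lra.
  - intros s Hs Hd.
    assert (m0 (v2 s) <= m0 (v1 s)).
    { apply Series_le; [|apply N1; lra]; intros n; split.
      - apply (N2 s ltac:(lra)); lia.
      - rewrite (coag_flow_gauge M v1 v2 mu1 (fun t => m0 (v2 t)) th1 th2 F1 F2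
                  (fun u Hu => m0_nonneg _ (N2 u Hu)) H0 (S n) s ltac:(lia) ltac:(lra)).
        rewrite <- (Rmult_1_l (v2 s (S n))) at 1.
        apply Rmult_le_compat_r; [apply (N2 s ltac:(lra)); lia|].
        rewrite <- exp_0; left; apply exp_increasing, Rmult_lt_0_compat; [|lra].
        apply lt_0_INR; lia. }
    specialize (Hmu s ltac:(lra)); lra.
  - rewrite (flow_theta_0 _ _ _ _ F1), (flow_theta_0 _ _ _ _ F2); lra.
Qed.

(** * Subcritical and critical solutions as flows *)

Lemma ex_RInt_Phi_sub (lam : R -> R) (v : R -> nat -> R) (t : R) :
  sub_sol lam v -> 0 <= t -> ex_RInt (Phi v) 0 t.
Proof. intros (_ & _ & H & _) Ht; apply ex_RInt_nondecreasing; auto. Qed.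

(** The [lam] term is absorbed into the deletion rate. The integral equations give continuity of
    each component; with right continuity of the mass the integrands are right continuous, which
    gives right derivatives at every time. *)
Lemma sub_sol_flow (lam : R -> R) (v : R -> nat -> R) :
  (forall t, continuous lam t) -> sub_sol lam v ->
  coag_flow (m0 (v 0)) v (fun t => m0 (v t) + lam t)
    (fun t => RInt (Phi v) 0 t - RInt lam 0 t).
Proof.
  intros Hlam Hv.
  assert (HPhi := fun t => ex_RInt_Phi_sub lam v t Hv).
  destruct Hv as (HN & HI & Hmono & _).
  assert (Hlam0 : forall t, 0 <= t -> ex_RInt lam 0 t)
    by (intros t _; apply (ex_RInt_continuous lam); auto).
  set (g := fun k s => coag_rhs (v s) k (m0 (v s) + lam s)).
  assert (Hg : forall k t, (1 <= k)%nat -> 0 <= t -> is_RInt (g k) 0 t (v t k - v 0 k)).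
  { intros k t Hk Ht; apply is_RInt_ext with (2 := HI k t Hk Ht).
    intros x _; apply Rminus_diag_uniq; unfold g, coag_rhs; ring. }
  assert (Hex : forall k, (1 <= k)%nat -> forall t, 0 <= t -> ex_RInt (g k) 0 t)
    by (intros k Hk t Ht; eexists; now apply Hg).
  assert (Eg : forall k, (1 <= k)%nat -> forall t, 0 <= t -> v 0 k + RInt (g k) 0 t = v t k).
  { intros k Hk t Ht; rewrite (is_RInt_unique _ _ _ _ (Hg k t Hk Ht)); ring. }
  assert (Hc : forall k, (1 <= k)%nat -> cont0 (fun s => v s k)).
  { intros k Hk; apply (cont0_ext _ _ (Eg k Hk)).
    apply cont0_plus; [apply cont0_const|apply cont0_RInt, Hex, Hk]. }
  assert (Hm : forall t, 0 <= t ->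
            filterlim (fun s => m0 (v s)) (at_right t) (locally (m0 (v t)))).
  { intros t Ht; apply m0_at_right; auto.
    intros s Hs; specialize (Hmono t s Ht Hs); unfold Phi in Hmono; lra. }
  assert (Hlr : forall t, 0 <= t -> filterlim lam (at_right t) (locally (lam t))).
  { intros t Ht; apply cont0_at_right, cont0_of_continuous; auto. }
  split.
  - exact Hc.
  - intros k t Hk Ht.
    apply rderiv_ext with (fun s => v 0 k + RInt (g k) 0 s).
    + intros s Hs; apply Eg; [exact Hk|lra].
    + rewrite <- Rplus_0_l; apply rderiv_plus; [apply rderiv_const|].
      apply rderiv_RInt; [exact Ht|apply Hex, Hk|].
      apply (coag_rhs_at_right v (fun s => m0 (v s) + lam s)); auto.
      apply (filterlim_Rplus (at_right t)); auto.
  - apply cont0_minus; apply cont0_RInt; auto.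
  - rewrite !RInt_point; unfold zero; simpl; ring.
  - intros t Ht.
    replace (m0 (v 0) - (m0 (v t) + lam t)) with (Phi v t - lam t) by (unfold Phi; ring).
    apply rderiv_minus; apply rderiv_RInt; auto.
    apply (filterlim_Rplus (at_right t)); [apply filterlim_const|].
    apply (filterlim_Ropp (at_right t)); auto.
Qed.

Lemma crit_sol_flow (v : R -> nat -> R) : crit_sol v ->
  coag_flow (m0 (v 0)) v (fun t => m0 (v t)) (RInt (Phi v) 0).
Proof.
  intros Hv.
  destruct (sub_sol_flow (fun _ => 0) v (fun t => continuous_const 0 t) Hv) as [H1 H2 H3 H4 H5].
  assert (E : forall t, RInt (Phi v) 0 t - RInt (fun _ => 0) 0 t = RInt (Phi v) 0 t)
    by (intros t; rewrite RInt_Rconst; ring).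
  split; auto.
  - intros k t Hk Ht; specialize (H2 k t Hk Ht); now rewrite Rplus_0_r in H2.
  - apply (cont0_ext _ _ (fun s _ => E s) H3).
  - now rewrite <- E.
  - intros t Ht; specialize (H5 t Ht); rewrite Rplus_0_r in H5.
    apply (rderiv_ext _ _ t _ (fun s _ => E s) H5).
Qed.

(** * Growth of partial sums under coagulation *)

Lemma sum_n_m_rev (a : nat -> R) (n : nat) :
  sum_n_m a 1 n = sum_n_m (fun l => a (S n - l)%nat) 1 n.
Proof.
  induction n as [|n IH]; [now rewrite !sum_n_m_zero by lia|].
  rewrite sum_n_m_1_S, IH, (sum_Sn_m _ 1 (S n)) by lia.
  rewrite <- (sum_n_m_S (fun l => a (S (S n) - l)%nat)).
  unfold plus; simpl; apply Rplus_comm.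
Qed.

(** The products are symmetric under exchange of [l] and [k - l], and these two weights average to
    [k / 2]. *)
Lemma half_conv (w : nat -> R) (k : nat) : (1 <= k)%nat ->
  INR k / 2 * conv w k = sum_n_m (fun l => INR l * w l * w (k - l)%nat) 1 (k - 1).
Proof.
  intros Hk; unfold conv.
  set (A := sum_n_m (fun l => INR l * w l * w (k - l)%nat) 1 (k - 1)).
  assert (E : INR k * sum_n_m (fun l => w l * w (k - l)%nat) 1 (k - 1) = A + A).
  2:{ apply Rmult_eq_reg_l with 2; [|lra].
      rewrite <- Rmult_assoc; replace (2 * (INR k / 2)) with (INR k) by field.
      rewrite E; ring. }
  unfold A at 2; rewrite (sum_n_m_rev (fun l => INR l * w l * w (k - l)%nat)); unfold A.
  rewrite <- sum_n_m_Rscal, <- sum_n_m_Rplus.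
  apply sum_n_m_Rext; intros l Hl.
  replace (S (k - 1) - l)%nat with (k - l)%nat by lia.
  replace (k - (k - l))%nat with l by lia.
  rewrite minus_INR by lia; ring.
Qed.

(** Exchange of summation over the pairs l < k <= K. In the induction step each inner sum gains one
    term, and the new outer term has an empty inner sum. *)
Lemma sum_triangle (a w : nat -> R) (K : nat) :
  sum_n_m (fun k => sum_n_m (fun l => a l * w (k - l)%nat) 1 (k - 1)) 1 K =
  sum_n_m (fun l => a l * sum_n_m w 1 (K - l)) 1 K.
Proof.
  induction K as [|K IH]; [now rewrite !sum_n_m_zero by lia|].
  rewrite !sum_n_m_1_S, IH, Nat.sub_diag, (sum_n_m_zero w 1 0) by lia.
  replace (S K - 1)%nat with K by lia.
  change (@zero _) with 0; rewrite Rmult_0_r, Rplus_0_r.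
  rewrite <- sum_n_m_Rplus; apply sum_n_m_Rext; intros l Hl.
  replace (S K - l)%nat with (S (K - l)) by lia.
  rewrite sum_n_m_1_S; ring.
Qed.

Lemma partial_sum_incr (w : nat -> R) (j K : nat) : (forall k, (1 <= k)%nat -> 0 <= w k) ->
  (j <= K)%nat -> sum_n_m w 1 j <= sum_n_m w 1 K.
Proof.
  intros Hw H; induction H as [|K H IH]; [lra|].
  rewrite sum_n_m_1_S; specialize (Hw (S K) ltac:(lia)); lra.
Qed.

(** The gain runs over pairs of sizes with sum at most [K]; enlarging to all pairs of sizes up to
    [K] gives first moment times mass. The excess of the partial sum over [m] thus obeys a linear
    differential inequality. *)
Lemma sum_coag_rhs_le (w : nat -> R) (m : R) (K : nat) :
  (forall k, (1 <= k)%nat -> 0 <= w k) ->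
  sum_n_m (fun k => coag_rhs w k m) 1 K <=
  sum_n_m (fun k => INR k * w k) 1 K * (sum_n_m w 1 K - m).
Proof.
  intros Hw; set (S1 := sum_n_m w 1 K).
  rewrite (sum_n_m_Rext _
    (fun k => sum_n_m (fun l => INR l * w l * w (k - l)%nat) 1 (k - 1) + - m * (INR k * w k))).
  2:{ intros k Hk; unfold coag_rhs; rewrite half_conv by lia; ring. }
  rewrite sum_n_m_Rplus, sum_n_m_Rscal, (sum_triangle (fun l => INR l * w l)).
  assert (sum_n_m (fun l => INR l * w l * sum_n_m w 1 (K - l)) 1 K
          <= sum_n_m (fun l => S1 * (INR l * w l)) 1 K).
  { apply sum_n_m_le_loc; intros l Hl; rewrite Rmult_comm.
    apply Rmult_le_compat_r.
    - apply Rmult_le_pos; [apply pos_INR|apply Hw; lia].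
    - apply partial_sum_incr; [exact Hw|lia]. }
  rewrite sum_n_m_Rscal in H; lra.
Qed.

Lemma first_moment_le (w : nat -> R) (K : nat) : (forall k, (1 <= k)%nat -> 0 <= w k) ->
  sum_n_m (fun k => INR k * w k) 1 K <= INR K * sum_n_m w 1 K.
Proof.
  intros Hw; rewrite <- sum_n_m_Rscal; apply sum_n_m_le_loc; intros k Hk.
  apply Rmult_le_compat_r; [apply Hw; lia|apply le_INR; lia].
Qed.

(** * Alternating solutions as flows *)

Lemma cont0_continuity_pt (f : R -> R) (x : R) :
  cont0 f -> continuity_pt (fun y => f (Rmax 0 y)) x.
Proof.
  intros Hf; apply continuity_pt_filterlim, filterlim_locally; intros eps.
  destruct (proj1 (within_eps _ _ _ _) (Hf (Rmax 0 x) (Rmax_l _ _)) eps (cond_pos eps))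
    as [d [Hd H]].
  exists (mkposreal d Hd); intros y Hy; apply H; [apply Rmax_l|].
  apply Rle_lt_trans with (2 := Hy); change (Rabs (Rmax 0 y - Rmax 0 x) <= Rabs (y - x)).
  unfold Rmax; destruct (Rle_dec 0 y), (Rle_dec 0 x); unfold Rabs;
    repeat destruct Rcase_abs; lra.
Qed.

Lemma rderiv_limit (f df : R -> R) (a b l : R) : 0 <= a < b -> cont0 f ->
  (forall t, a < t < b -> is_derive f t (df t)) ->
  filterlim df (at_right a) (locally l) -> rderiv f a l.
Proof.
  intros Ha Hf Hd Hl; apply rderiv_intro; intros eps Heps.
  destruct (proj1 (within_eps _ _ _ _) Hl eps Heps) as [d [Hd0 H]].
  exists (Rmin d (b - a)); split; [apply Rmin_glb_lt; lra|]; intros s Hs.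
  pose proof (Rmin_l d (b - a)); pose proof (Rmin_r d (b - a)).
  (* The mean value theorem wants two-sided continuity at the endpoints; extending [f] by a constant
     to negative times provides it even when [a = 0]. *)
  set (F := fun y => f (Rmax 0 y)).
  assert (EF : forall y, 0 <= y -> F y = f y)
    by (intros y Hy; unfold F; now rewrite Rmax_right).
  rewrite <- !EF by lra.
  (* The intermediate point may be the endpoint [a], where [df] is not controlled; the value [l]
     there makes that case trivial. *)
  destruct (MVT_gen F a s (fun y => if Req_dec_T y a then l else df y)) as [c [Hc Ec]].
  - rewrite Rmin_left, Rmax_right by lra; intros x Hx.
    destruct (Req_dec_T x a) as [e|_]; [lra|].
    apply is_derive_ext_loc with f; [|apply Hd; lra].
    exists (mkposreal x ltac:(lra)); intros y Hy; symmetry; apply EF.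
    change (Rabs (y - x) < x) in Hy; apply Rabs_def2 in Hy; lra.
  - intros x _; now apply cont0_continuity_pt.
  - rewrite Rmin_left, Rmax_right in Hc by lra.
    rewrite Ec, <- Rmult_minus_distr_r, Rabs_mult, (Rabs_right (s - a)) by lra.
    apply Rmult_le_compat_r; [lra|].
    destruct (Req_dec_T c a) as [e|e].
    + rewrite Rminus_diag, Rabs_R0; lra.
    + left; apply H; [lra|rewrite Rabs_right; lra].
Qed.

Lemma burning_lt (b : nat -> R) (i j : nat) : burning b -> (i < j)%nat -> b i < b j.
Proof.
  intros (_ & H & _) Hij; induction Hij as [|j _ IH]; [apply H|].
  specialize (H j); lra.
Qed.

Lemma burning_le (b : nat -> R) (i j : nat) : burning b -> (i <= j)%nat -> b i <= b j.
Proof.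
  intros Hb Hij; destruct (Nat.eq_dec i j) as [->|Hne]; [lra|].
  left; apply burning_lt; [exact Hb|lia].
Qed.

Lemma burning_nonneg (b : nat -> R) (i : nat) : burning b -> 0 <= b i.
Proof. intros Hb; rewrite <- (proj1 Hb); apply burning_le; [exact Hb|lia]. Qed.

Lemma burning_index (b : nat -> R) (t : R) : burning b -> 0 <= t ->
  exists i, b i <= t < b (S i).
Proof.
  intros (H0 & _ & H) Ht; destruct (H t) as [n Hn]; revert Hn.
  induction n as [|n IH]; intros Hn; [rewrite H0 in Hn; lra|].
  destruct (Rlt_dec t (b n)) as [c|c]; [now apply IH|].
  exists n; lra.
Qed.

Lemma Mtime_eq (b : nat -> R) (i : nat) (t : R) : burning b -> b i < t <= b (S i) ->
  Mtime b t = i.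
Proof.
  intros Hb Hi.
  assert (Hj : b (Mtime b t) < t <= b (S (Mtime b t)))
    by (unfold Mtime; apply epsilon_spec; now exists i).
  destruct (Nat.lt_trichotomy (Mtime b t) i) as [c|[c|c]]; [exfalso|exact c|exfalso].
  - pose proof (burning_le b (S (Mtime b t)) i Hb c); lra.
  - pose proof (burning_le b (S i) (Mtime b t) Hb c); lra.
Qed.

(* [Mtime] is left continuous in time; this is its right-continuous counterpart, the
   index needed for right derivatives. *)
Definition burn_index (b : nat -> R) (t : R) : nat :=
  epsilon (inhabits 0%nat) (fun i => b i <= t < b (S i)).

Lemma burn_index_spec (b : nat -> R) (t : R) : burning b -> 0 <= t ->
  b (burn_index b t) <= t < b (S (burn_index b t)).
Proof. intros Hb Ht; unfold burn_index; apply epsilon_spec, burning_index; auto. Qed.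

Lemma alt_sol_cont0 (b : nat -> R) (v : R -> nat -> R) (k : nat) :
  alt_sol b v -> (1 <= k)%nat -> cont0 (fun s => v s k).
Proof. intros (_ & H & _) Hk t Ht; now apply H. Qed.

(** At the burning time [b i] the equation prescribes no derivative; the right derivative is
    recovered as a limit of later derivatives. *)
Lemma alt_sol_rderiv (b : nat -> R) (v : R -> nat -> R) (i k : nat) (t : R) :
  burning b -> alt_sol b v -> (1 <= k)%nat -> b i <= t < b (S i) ->
  rderiv (fun s => v s k) t (coag_rhs (v t) k (m0 (v (b i)))).
Proof.
  intros Hb Hv Hk Ht; pose proof (burning_nonneg b i Hb).
  apply rderiv_limit with (b := b (S i)) (df := fun s => coag_rhs (v s) k (m0 (v (b i)))).
  - lra.
  - now apply (alt_sol_cont0 b).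
  - intros s Hs; apply Hv; [exact Hk|lra].
  - apply (coag_rhs_at_right v (fun _ => m0 (v (b i)))).
    + lra.
    + exact Hk.
    + intros j Hj; now apply (alt_sol_cont0 b).
    + apply filterlim_const.
Qed.

(** Each partial sum starts at or below [m] and cannot cross it, by the linear inequality for its
    excess; the supremum over [K] bounds the mass. *)
Lemma alt_sol_m0_le (b : nat -> R) (v : R -> nat -> R) (i : nat) (t : R) :
  burning b -> alt_sol b v -> b i <= t <= b (S i) -> m0 (v t) <= m0 (v (b i)).
Proof.
  intros Hb Hv Ht.
  assert (HN := proj1 Hv); pose proof (burning_nonneg b i Hb) as Hbi.
  set (m := m0 (v (b i))).
  assert (Hm : 0 <= m) by (now apply m0_nonneg, HN).
  apply m0_le_of_partial_sums; [apply HN; lra|]; intros K.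
  cut (sum_n_m (v t) 1 K - m <= 0); [lra|].
  (* Where the excess is at most 1, the partial sum is at most [m + 1] and its first moment at most
     [INR K * (m + 1)], which explains the constant. *)
  apply (rderiv_gronwall (fun s => sum_n_m (v s) 1 K - m)
           (fun s => sum_n_m (fun k => coag_rhs (v s) k m) 1 K - 0) (INR K * (m + 1)) (b i) t).
  - exact Hbi.
  - apply cont0_minus; [|apply cont0_const].
    apply (cont0_sum v); intros k Hk; apply (alt_sol_cont0 b); [exact Hv|lia].
  - intros s Hs; apply rderiv_minus; [|apply rderiv_const].
    apply (rderiv_sum v); intros k Hk; apply (alt_sol_rderiv b); auto; [lia|lra].
  - intros s Hs Hf.
    assert (Hpos : forall k, (1 <= k)%nat -> 0 <= v s k) by (apply HN; lra).
    pose proof (sum_coag_rhs_le (v s) m K Hpos).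
    assert (sum_n_m (fun k => INR k * v s k) 1 K <= INR K * (m + 1)).
    { apply Rle_trans with (1 := first_moment_le (v s) K Hpos).
      apply Rmult_le_compat_l; [apply pos_INR|lra]. }
    apply (Rmult_le_compat_r (sum_n_m (v s) 1 K - m)) in H0; lra.
  - pose proof (partial_sum_le_m0 (v (b i)) K (HN _ Hbi)); unfold m; lra.
  - lra.
Qed.

Lemma Phi_alt_eq (b : nat -> R) (v : R -> nat -> R) (i : nat) (t : R) :
  burning b -> b i < t <= b (S i) -> Phi_alt v b t = m0 (v 0) - m0 (v (b i)).
Proof. intros Hb Ht; unfold Phi_alt; now rewrite (Mtime_eq b i). Qed.

Lemma ex_RInt_Phi_alt (b : nat -> R) (v : R -> nat -> R) (t : R) :
  burning b -> 0 <= t -> ex_RInt (Phi_alt v b) 0 t.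
Proof.
  intros Hb Ht; destruct (burning_index b t Hb Ht) as [n Hn].
  (* The interval is enlarged to end at a burning time, and induction then adds one interval of
     constancy at a time. *)
  apply (ex_RInt_Chasles_1 (Phi_alt v b) 0 t (b (S n))); [lra|].
  generalize (S n) as i; clear n Hn; induction i as [|i IH].
  - rewrite (proj1 Hb); apply ex_RInt_point.
  - apply ex_RInt_Chasles with (1 := IH).
    apply ex_RInt_ext with (fun _ => m0 (v 0) - m0 (v (b i))); [|apply ex_RInt_const].
    pose proof (burning_lt b i (S i) Hb (le_n _)).
    rewrite Rmin_left, Rmax_right by lra; intros x Hx.
    symmetry; apply Phi_alt_eq; [exact Hb|lra].
Qed.

Lemma alt_sol_flow (b : nat -> R) (v : R -> nat -> R) : burning b -> alt_sol b v ->
  coag_flow (m0 (v 0)) v (fun t => m0 (v (b (burn_index b t)))) (RInt (Phi_alt v b) 0).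
Proof.
  intros Hb Hv.
  assert (Hex := fun t => ex_RInt_Phi_alt b v t Hb).
  split.
  - intros k Hk; now apply (alt_sol_cont0 b).
  - intros k t Hk Ht; apply (alt_sol_rderiv b); auto; now apply burn_index_spec.
  - now apply cont0_RInt.
  - exact (RInt_point 0 (Phi_alt v b)).
  - intros t Ht; apply rderiv_RInt; auto.
    pose proof (burn_index_spec b t Hb Ht) as Hi; set (i := burn_index b t) in *.
    (* Just after [t], and until [b (S i)], the left-continuous index in [Phi_alt] equals [i] as
       well, so the function is constant there. *)
    apply within_eps; intros eps Heps; exists (b (S i) - t); split; [lra|].
    intros s Ds Hs; rewrite Rabs_right in Hs by lra.
    rewrite (Phi_alt_eq b v i) by (auto; lra).
    rewrite Rminus_diag, Rabs_R0; exact Heps.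
Qed.

(** * The two inequalities *)

Lemma m0_ext (w u : nat -> R) : (forall k, (1 <= k)%nat -> w k = u k) -> m0 w = m0 u.
Proof. intros H; apply Series_ext; intros n; apply H; lia. Qed.

Theorem theorem10 (v0 : nat -> R) (T : R) (hv0 : in_Nstar v0) (hT : 0 < T) :
  (forall (lam : R -> R) (vcrit vsub : R -> nat -> R),
     (forall t, continuous lam t) ->
     (exists c, 0 < c /\ forall t, 0 <= t -> c <= lam t) ->
     crit_sol vcrit -> (forall k, (1 <= k)%nat -> vcrit 0 k = v0 k) ->
     sub_sol lam vsub -> (forall k, (1 <= k)%nat -> vsub 0 k = v0 k) ->
     RInt (Phi vsub) 0 T - RInt lam 0 T <= RInt (Phi vcrit) 0 T)
  /\
  (forall (b : nat -> R) (vcrit valt : R -> nat -> R),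
     crit_sol vcrit -> (forall k, (1 <= k)%nat -> vcrit 0 k = v0 k) ->
     burning b ->
     alt_sol b valt -> (forall k, (1 <= k)%nat -> valt 0 k = v0 k) ->
     RInt (Phi_alt valt b) 0 T <= RInt (Phi vcrit) 0 T).
Proof.
  split.
  - intros lam vc vs Hlam (c & Hc & Hlc) Hcrit Ec Hsub Es.
    assert (E : forall k, (1 <= k)%nat -> vs 0 k = vc 0 k)
      by (intros k Hk; now rewrite Es, Ec).
    (* Both flows must carry the same constant [M]; the initial data agree for indices from 1 on,
       which determines the mass. *)
    assert (F2 := crit_sol_flow vc Hcrit); rewrite <- (m0_ext _ _ E) in F2.
    apply (coag_flow_theta_le _ _ _ _ _ _ (sub_sol_flow lam vs Hlam Hsub) F2
             (proj1 Hsub) (proj1 Hcrit)); [|exact E|lra].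
    intros t Ht; specialize (Hlc t Ht); lra.
  - intros b vc va Hcrit Ec Hb Halt Ea.
    assert (E : forall k, (1 <= k)%nat -> va 0 k = vc 0 k)
      by (intros k Hk; now rewrite Ea, Ec).
    assert (F2 := crit_sol_flow vc Hcrit); rewrite <- (m0_ext _ _ E) in F2.
    apply (coag_flow_theta_le _ _ _ _ _ _ (alt_sol_flow b va Hb Halt) F2
             (proj1 Halt) (proj1 Hcrit)); [|exact E|lra].
    intros t Ht; apply alt_sol_m0_le; auto.
    pose proof (burn_index_spec b t Hb Ht); lra.
Qed.
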